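(* Let $r\ge 1$ and let $\mathcal{P}_0,\mathcal{P}_1,\ldots,\mathcal{P}_r$ be palettes. There exists a hypergraph $H$ that is $\mathcal{P}_s$-colorable for every $s\in[r]$ but not $\mathcal{P}_0$-colorable if and only if for every $q\in[r]$ there is no homomorphism from the palette $\mathcal{P}_q\times\prod_{s\in[r]\setminus\{q\}}\mathrm{sym}(\mathcal{P}_s)$ to $\mathcal{P}_0$ and no homomorphism from it to $\mathrm{inv}(\mathcal{P}_0)$.
   Context: All hypergraphs are finite and $3$-uniform. A palette $\mathcal{P}=(C,T)$ consists of a finite nonempty set $C$ of colors and a set $T\subseteq C^3$ of feasible triples. An ordered hypergraph is a hypergraph together with a linear order $\preceq$ on its vertex set. An ordered hypergraph is $\mathcal{P}$-colorable if there is a coloring $c$ of the $2$-element subsets of its vertex set by colors from $C$ such that for every edge $\{u,v,w\}$ with $u\prec v\prec w$ we have $(c(uv),c(uw),c(vw))\in T$. A (non-ordered) hypergraph is $\mathcal{P}$-colorable if there is a linear order of its vertex set making it a $\mathcal{P}$-colorable ordered hypergraph. The inverse palette $\mathrm{inv}(\mathcal{P})=(C,T')$ has $(x,y,z)\in T'$ iff $(z,y,x)\in T$. A homomorphism from $(C,T)$ to $(C',T')$ is a map $f:C\to C'$ with $(f(x),f(y),f(z))\in T'$ for all $(x,y,z)\in T$. The product $\prod_{i\in[k]}(C_i,T_i)$ is the palette with color set $C_1\times\cdots\times C_k$ in which $((x_i)_i,(y_i)_i,(z_i)_i)$ is feasible iff $(x_i,y_i,z_i)\in T_i$ for all $i$.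 The symmetrization $\mathrm{sym}(\mathcal{P})$ of $\mathcal{P}=(C,T)$ has color set $C\cup\{\bar c: c\in C\}$, where $\bar c$ are new colors (clones), and feasible triple set $\bigcup_{(x,y,z)\in T}\{(x,y,z),(\bar x,z,y),(y,x,\bar z),(\bar y,\bar z,x),(z,\bar x,\bar y),(\bar z,\bar y,\bar x)\}$. *)

(* Defs.v *)
From mathcomp Require Import all_boot.

Set Implicit Arguments.
Unset Strict Implicit.
Unset Printing Implicit Defensive.

Record palette := Palette {
  color : finType;
  feasible : {set color * color * color};
  color_gt0 : 0 < #|color|
}.

Record hypergraph := Hypergraph {
  vertex : finType;
  edges : {set {set vertex}};
  edges_card3 : forall e, e \in edges -> #|e| = 3
}.

Record linear_order (V : Type) := LinearOrder {
  le_rel :> rel V;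
  le_refl : reflexive le_rel;
  le_anti : antisymmetric le_rel;
  le_trans : transitive le_rel;
  le_total : total le_rel
}.

Definition prec (V : eqType) (o : linear_order V) (u v : V) : bool :=
  (u != v) && o u v.

Record ordered_hypergraph := OrderedHypergraph {
  underlying : hypergraph;
  vorder : linear_order (vertex underlying)
}.

(* A coloring of pairs is a total function on vertex sets, but only its values
   on the 2-element sets [set u; v] with u != v matter; since the set of colors
   is nonempty, every coloring of the 2-element sets extends to such a
   function. *)
Definition ordered_colorable (P : palette) (G : ordered_hypergraph) : Prop :=
  exists c : {set vertex (underlying G)} -> color P,
    forall u v w : vertex (underlying G),
      [set u; v; w] \in edges (underlying G) ->
      prec (vorder G) u v -> prec (vorder G) v w ->
      (c [set u; v], c [set u; w], c [set v; w]) \in feasible P.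

Definition colorable (P : palette) (H : hypergraph) : Prop :=
  exists o : linear_order (vertex H),
    ordered_colorable P (OrderedHypergraph o).

Definition homomorphic (P Q : palette) : Prop :=
  exists f : color P -> color Q, forall x y z : color P,
    (x, y, z) \in feasible P -> (f x, f y, f z) \in feasible Q.

Definition inv_palette (P : palette) : palette :=
  @Palette (color P)
    [set t : color P * color P * color P |
      let: (x, y, z) := t in (z, y, x) \in feasible P]
    (color_gt0 P).

Section Prod2.

Variables P Q : palette.

Lemma prod2_color_gt0 : 0 < #|{: color P * color Q}|.
Proof. by rewrite card_prod muln_gt0 !color_gt0. Qed.

Definition prod2_palette : palette :=
  @Palette (color P * color Q)%type
    [set t : (color P * color Q) * (color P * color Q) * (color P * color Q) |
      let: (x, y, z) := t in
      ((x.1, y.1, z.1) \in feasible P) && ((x.2, y.2, z.2) \in feasible Q)]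
    prod2_color_gt0.

End Prod2.

Section Prod.

Variables (I : finType) (P : I -> palette).

Let prod_color : finType := {dffun forall i : I, color (P i)}.

Lemma prod_color_gt0 : 0 < #|prod_color|.
Proof.
rewrite card_dep_ffun foldrE big_map.
by apply: prodn_gt0 => i; apply: color_gt0.
Qed.

(* When I is empty this is the palette with one color and one feasible triple,
   the neutral element for products. *)
Definition prod_palette : palette :=
  @Palette prod_color
    [set t : prod_color * prod_color * prod_color |
      let: (x, y, z) := t in [forall i, (x i, y i, z i) \in feasible (P i)]]
    prod_color_gt0.

End Prod.

Section Sym.

Variable P : palette.

Let clr (x : color P) : color P + color P := inl x.
Let bar (x : color P) : color P + color P := inr x.

Lemma sym_color_gt0 : 0 < #|{: color P + color P}|.
Proof. by rewrite card_sum addn_gt0 color_gt0. Qed.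

(* inl x is the original color x and inr x is its clone. *)
Definition sym_palette : palette :=
  @Palette (color P + color P)%type
    (\bigcup_(t in feasible P)
      let: (x, y, z) := t in
      [set (clr x, clr y, clr z); (bar x, clr z, clr y);
           (clr y, clr x, bar z); (bar y, bar z, clr x);
           (clr z, bar x, bar y); (bar z, bar y, bar x)])
    sym_color_gt0.

End Sym.

Definition mixed_palette (r : nat) (P : 'I_r -> palette) (q : 'I_r) : palette :=
  prod2_palette (P q)
    (prod_palette (fun s : {s : 'I_r | s != q} => sym_palette (P (val s)))).

(* Main.v *)
Require Import Defs.
From mathcomp Require Import all_boot.

(** If a hypergraph has a [P s]-colouring in an order [o s] for every [s], then
    in the order [o q] the colours of the [P s], barred on the pairs where [o s]
    disagrees with [o q], form a colouring by the mixed palette of [q]; so a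
    homomorphism to [P0] or to its inverse makes the hypergraph [P0]-colourable.

    Conversely, take vertices carrying [r] linear orders and a label
    [(a_s)_s] on each pair, and let the edges be all triples that are feasible
    for every [s].  By a partite construction (Hales-Jewett) over the grid
    [N^r], combined with the product Ramsey theorem, the vertices can be chosen
    such that for every order [o] and every [P0]-colouring all patterns of three
    points occur with both the colour of a pair and its direction in [o]
    depending only on its label and on its directions in the [r] orders.
    Transitivity of [o] then forces it to follow, or to reverse, one fixed order
    [q], by the ultrafilter argument of Arrow's theorem, and the dependence of
    the colour on label and directions is a homomorphism from the mixed palette
    of [q]. *)

Set Implicit Arguments.
Unset Strict Implicit.
Unset Printing Implicit Defensive.

(** * The Hales-Jewett theorem *)

(** [None] marks the moving coordinates of a combinatorial line; they all receive the same letter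
    [a]. *)
Definition line_point (J A : finType) (l : {ffun J -> option A}) (a : A) :
  {ffun J -> A} := [ffun j => odflt a (l j)].

Definition active (J A : finType) (l : {ffun J -> option A}) :=
  [exists j, l j == None].

Definition monochromatic (J A : finType) (S : Type)
    (chi : {ffun J -> A} -> S) (l : {ffun J -> option A}) :=
  active l /\ forall a b, chi (line_point l a) = chi (line_point l b).

Definition hales_jewett_for (A S : finType) :=
  exists J : finType, forall chi : {ffun J -> A} -> S,
    exists l, monochromatic chi l.

Definition cat_word (J1 J2 A : finType) (w1 : {ffun J1 -> A})
    (w2 : {ffun J2 -> A}) : {ffun J1 + J2 -> A} :=
  [ffun j => match j with inl x => w1 x | inr y => w2 y end].

Lemma line_point_cat (J1 J2 A : finType) (l1 : {ffun J1 -> option A})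
    (l2 : {ffun J2 -> option A}) a :
  line_point (cat_word l1 l2) a = cat_word (line_point l1 a) (line_point l2 a).
Proof. by apply/ffunP => -[j|j]; rewrite !ffunE. Qed.

Lemma active_catl (J1 J2 A : finType) (l1 : {ffun J1 -> option A})
    (l2 : {ffun J2 -> option A}) : active l1 -> active (cat_word l1 l2).
Proof. by case/existsP=> j lj; apply/existsP; exists (inl j); rewrite ffunE. Qed.

Lemma active_catr (J1 J2 A : finType) (l1 : {ffun J1 -> option A})
    (l2 : {ffun J2 -> option A}) : active l2 -> active (cat_word l1 l2).
Proof. by case/existsP=> j lj; apply/existsP; exists (inr j); rewrite ffunE. Qed.

Definition some_word (J A : finType) (w : {ffun J -> A}) : {ffun J -> option A} :=
  [ffun j => Some (w j)].

Lemma line_point_some (J A : finType) (w : {ffun J -> A}) a :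
  line_point (some_word w) a = w.
Proof. by apply/ffunP => j; rewrite !ffunE. Qed.

Definition lift_line (J A : finType) (l : {ffun J -> option A}) :
  {ffun J -> option (option A)} := [ffun j => omap Some (l j)].

Lemma line_point_lift (J A : finType) (l : {ffun J -> option A}) a :
  line_point (lift_line l) (Some a) = some_word (line_point l a).
Proof. by apply/ffunP => j; rewrite !ffunE; case: (l j). Qed.

Lemma active_lift (J A : finType) (l : {ffun J -> option A}) :
  active l -> active (lift_line l).
Proof.
by case/existsP=> j /eqP lj; apply/existsP; exists j; rewrite ffunE lj.
Qed.

(* The colour-focusing step: the lines share their last point [f], and each is
   monochromatic off [f], with pairwise distinct colours. *)
Lemma color_focusing (A S : finType) (a0 : A) :
  (forall S' : finType, hales_jewett_for A S') ->
  forall k, exists J : finType, forall chi : {ffun J -> option A} -> S,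
    (exists l, monochromatic chi l) \/
    (exists (C : {set S}) (f : {ffun J -> option A}),
       #|C| = k /\ forall c, c \in C -> exists l,
         [/\ active l, line_point l None = f
           & forall a, chi (line_point l (Some a)) = c]).
Proof.
move=> HJ; elim=> [|k [J1 IH]].
  exists void => chi; right; exists set0, [ffun=> None].
  by rewrite cards0; split=> // c; rewrite inE.
(* A word on [J2] is coloured by the whole colouring it induces on the words on [J1], so along [l2]
   the letter of [A] has no effect on [chi]. *)
have [J2 HJ2] := HJ {ffun {ffun J1 -> option A} -> S}.
exists (J2 + J1)%type => chi.
pose chi2 (w : {ffun J2 -> A}) := [ffun u => chi (cat_word (some_word w) u)].
have [l2 [act2 mono2]] := HJ2 chi2.
pose w0 := some_word (line_point l2 a0).
pose chi1 u := chi (cat_word w0 u).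
have chi1E a u : chi (cat_word (some_word (line_point l2 a)) u) = chi1 u.
  by move/ffunP/(_ u): (mono2 a a0); rewrite !ffunE.
have full l : monochromatic chi1 l -> exists l', monochromatic chi l'.
  case=> actl monol; exists (cat_word (some_word w0) l).
  split; first exact: active_catr.
  by move=> a b; rewrite !line_point_cat !line_point_some; apply: monol.
case: (IH chi1) => [[l /full]|[C [f [cardC focC]]]]; first by left.
(* If the focus has one of the focused colours, the line of that colour is monochromatic including
   its last point. *)
have [fC|fnC] := boolP (chi1 f \in C).
  left; have [l [actl lf lc]] := focC _ fC; apply: (full l); split=> //.
  have lE b : chi1 (line_point l b) = chi1 f.
    by case: b => [b|]; [rewrite lc | rewrite lf].
  by move=> a b; rewrite !lE.
(* Otherwise the colour of [f] is new: its line moves on [J2] only, while the old lines now move on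
   [J2] and [J1] together. *)
right; exists (chi1 f |: C), (cat_word (line_point (lift_line l2) None) f).
split; first by rewrite cardsU1 fnC cardC.
move=> c; rewrite !inE => /orP[/eqP->|/focC [l [actl lf lc]]].
  exists (cat_word (lift_line l2) (some_word f)); split.
  - exact/active_catl/active_lift.
  - by rewrite line_point_cat line_point_some.
  - by move=> a; rewrite line_point_cat line_point_some line_point_lift chi1E.
exists (cat_word (lift_line l2) l); split.
- exact: active_catr.
- by rewrite line_point_cat lf.
- by move=> a; rewrite line_point_cat line_point_lift chi1E.
Qed.

Lemma hales_jewett_trivial (A S : finType) :
  (forall a b : A, a = b) -> hales_jewett_for A S.
Proof.
move=> trivA; exists unit => chi; exists [ffun=> None]; split.
  by apply/existsP; exists tt; rewrite ffunE.
by move=> a b; rewrite (trivA a b).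
Qed.

Lemma hales_jewett_option (A : finType) :
  (forall S : finType, hales_jewett_for A S) ->
  forall S : finType, hales_jewett_for (option A) S.
Proof.
move=> HJ S; case: (pickP {: A}) => [a0 _|A0]; last first.
  apply: hales_jewett_trivial => -[a|] [b|] //; first by have := A0 a.
    by have := A0 a.
  by have := A0 b.
(* [S] has too few elements for [#|S|.+1] focused colours. *)
have [J focJ] := color_focusing S a0 HJ #|S|.+1.
exists J => chi; case: (focJ chi) => [//|[C [f [cardC _]]]].
by have := max_card (mem C); rewrite cardC ltnn.
Qed.

Lemma hales_jewett_surj (A B S : finType) (f : B -> A) (g : A -> B) :
  cancel f g -> hales_jewett_for A S -> hales_jewett_for B S.
Proof.
move=> fK [J HJ]; exists J => chi.
have [l [/existsP[j /eqP lj] monol]] := HJ (fun w => chi [ffun j => g (w j)]).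
exists [ffun j => omap g (l j)]; split.
  by apply/existsP; exists j; rewrite ffunE lj.
have lE b : line_point [ffun j => omap g (l j)] b
            = [ffun j => g (line_point l (f b) j)].
  by apply/ffunP => i; rewrite !ffunE; case: (l i) => [a|] //=; rewrite fK.
by move=> a b; rewrite !lE.
Qed.

Theorem hales_jewett (A S : finType) : hales_jewett_for A S.
Proof.
apply: (hales_jewett_surj (@enum_rankK A)).
elim: #|A| S => [|n IH] S; first by apply: hales_jewett_trivial => -[].
pose g (x : option 'I_n) := if x is Some i then lift ord0 i else ord0 : 'I_n.+1.
apply: (@hales_jewett_surj _ _ _ (unlift ord0) g).
  by move=> i; case: unliftP.
exact: hales_jewett_option.
Qed.

(** * Partite construction *)

Section PartiteSystems.

Variables (I K : finType).

Record system := System {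
  carrier :> finType;
  part : carrier -> I;
  lab : carrier -> carrier -> K;
  lab_sym : forall x y, lab x y = lab y x
}.

Definition embedding (A B : system) (phi : A -> B) :=
  (forall x, part (phi x) = part x) /\
  (forall x y, part x != part y -> lab (phi x) (phi y) = lab x y).

Section Amalgam.

Variables (A : system) (i j : I) (a : K) (J : finType).
Hypothesis ij : i != j.

(** A word of letters splits into the word of first and the word of second endpoints, that is, into
    a pair of vertices in parts [i] and [j] of the amalgam. *)
Definition letter : finType :=
  {p : A * A | [&& part p.1 == i, part p.2 == j & lab p.1 p.2 == a]}.

Notation line := {ffun J -> option letter}.

(* Parts [i] and [j] are replaced by words, whose pairs carry the lines of
   letters; every line gets its own copy of the remaining parts. *)
Definition amalgam_carrier : finType := ((bool * {ffun J -> A}) + (A * line))%type.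

Definition amalgam_part (u : amalgam_carrier) : I :=
  match u with
  | inl (b, _) => if b then i else j
  | inr (x, _) => part x
  end.

(** A vertex of part [i] or [j] is written at the moving coordinates of [l], where it can be read
    off again; the fixed coordinates hold endpoints of the letters of [l]. *)
Definition copy (l : line) (x : A) : amalgam_carrier :=
  if part x == i then
    inl (true, [ffun t => if l t is Some e then (val e).1 else x])
  else if part x == j then
    inl (false, [ffun t => if l t is Some e then (val e).2 else x])
  else inr (x, l).

Lemma part_copy l x : amalgam_part (copy l x) = part x.
Proof.
by rewrite /copy; case: eqP => [->|_] //; case: eqP => [->|].
Qed.

Lemma copyP_i l l' x x' : part x = i -> copy l x = copy l' x' ->
  forall t, (if l t is Some e then (val e).1 else x)
            = (if l' t is Some e then (val e).1 else x').
Proof.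
move=> xi e t.
have x'i : part x' = i by rewrite -(part_copy l') -e part_copy.
move: e; rewrite /copy xi x'i eqxx => -[/ffunP/(_ t)].
by rewrite !ffunE.
Qed.

Lemma copyP_j l l' x x' : part x = j -> copy l x = copy l' x' ->
  forall t, (if l t is Some e then (val e).2 else x)
            = (if l' t is Some e then (val e).2 else x').
Proof.
move=> xj e t.
have x'j : part x' = j by rewrite -(part_copy l') -e part_copy.
move: e; rewrite /copy xj x'j eqxx eq_sym (negbTE ij) => -[/ffunP/(_ t)].
by rewrite !ffunE.
Qed.

Lemma copyP_other l l' x x' : part x != i -> part x != j ->
  copy l x = copy l' x' -> l = l'.
Proof.
move=> xi xj e.
have xx' : part x' = part x by rewrite -(part_copy l') -e part_copy.
by move: e; rewrite /copy xx' (negbTE xi) (negbTE xj) => -[].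
Qed.

Lemma copy_inj l : active l -> injective (copy l).
Proof.
case/existsP=> t /eqP lt x x' e.
have [xi|xi] := eqVneq (part x) i; first by have := copyP_i xi e t; rewrite lt.
have [xj|xj] := eqVneq (part x) j; first by have := copyP_j xj e t; rewrite lt.
have xx' : part x' = part x by rewrite -(part_copy l) -e part_copy.
by move: e; rewrite /copy xx' (negbTE xi) (negbTE xj) => -[].
Qed.

(* A pair of words shared by two lines: at a moving coordinate of [l] the other
   line either moves too, or is a letter, which has label [a]. *)
Lemma lab_copy_ij l l' x y x' y' : active l ->
  part x = i -> part y = j ->
  copy l x = copy l' x' -> copy l y = copy l' y' ->
  lab x y = a \/ lab x y = lab x' y'.
Proof.
case/existsP=> t /eqP lt xi yj ex ey.
have := copyP_i xi ex t; have := copyP_j yj ey t; rewrite lt.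
case: (l' t) => [e|] -> ->; last by right.
by left; case: e => p /= /and3P[_ _ /eqP].
Qed.

(** Copies along different lines meet only in parts [i] and [j]; there [lab_copy_ij], used in both
    directions, leaves equal labels or twice the label [a]. *)
Lemma lab_copy l l' x y x' y' : active l -> active l' ->
  part x != part y -> copy l x = copy l' x' -> copy l y = copy l' y' ->
  lab x y = lab x' y'.
Proof.
move=> al al' xy ex ey.
have px : part x' = part x by rewrite -(part_copy l') -ex part_copy.
have py : part y' = part y by rewrite -(part_copy l') -ey part_copy.
have [ll'|ll'] := eqVneq l l'.
  by subst l'; rewrite (copy_inj al ex) (copy_inj al ey).
have wlogij u v u' v' : part u = i -> part v = j ->
    copy l u = copy l' u' -> copy l v = copy l' v' -> lab u v = lab u' v'.
  move=> ui vj eu ev.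
  have u'i : part u' = i by rewrite -(part_copy l') -eu part_copy.
  have v'j : part v' = j by rewrite -(part_copy l') -ev part_copy.
  have [|//] := lab_copy_ij al ui vj eu ev.
  have [|//] := lab_copy_ij al' u'i v'j (esym eu) (esym ev).
  by move=> -> ->.
have other z z' : copy l z = copy l' z' -> part z = i \/ part z = j.
  move=> e; have [|zi] := eqVneq (part z) i; first by left.
  have [|zj] := eqVneq (part z) j; first by right.
  by rewrite (copyP_other zi zj e) eqxx in ll'.
have [xi|xj] := other _ _ ex; have [yi|yj] := other _ _ ey.
- by rewrite xi yi eqxx in xy.
- exact: wlogij.
- by rewrite lab_sym (lab_sym x'); apply: wlogij.
- by rewrite xj yj eqxx in xy.
Qed.

Definition copied_pair (u v : amalgam_carrier) (t : line * A * A) : bool :=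
  let: (l, x, y) := t in
  [&& active l, part x != part y, copy l x == u & copy l y == v].

(** [lab_copy] makes the choice of the copy immaterial; [a] is an arbitrary value for pairs that lie
    in no copy. *)
Definition amalgam_lab (u v : amalgam_carrier) : K :=
  if [pick t | copied_pair u v t] is Some (_, x, y) then lab x y else a.

Lemma amalgam_lab_copy l x y : active l -> part x != part y ->
  amalgam_lab (copy l x) (copy l y) = lab x y.
Proof.
move=> al xy; rewrite /amalgam_lab; case: pickP => [[[l' x'] y']|].
  by case/and4P=> al' xy' /eqP ex /eqP ey; apply: lab_copy al' al xy' ex ey.
by move/(_ (l, x, y)); rewrite /= al xy !eqxx.
Qed.

Lemma amalgam_lab_sym u v : amalgam_lab u v = amalgam_lab v u.
Proof.
rewrite {1}/amalgam_lab; case: pickP => [[[l x] y]|uv0].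
  case/and4P=> al xy /eqP <- /eqP <-.
  by rewrite amalgam_lab_copy // 1?eq_sym // lab_sym.
rewrite /amalgam_lab; case: pickP => // -[[l x] y] /and4P[al xy xv yu].
by have := uv0 (l, y, x); rewrite /= al yu xv eq_sym xy.
Qed.

Definition amalgam : system :=
  @System amalgam_carrier amalgam_part amalgam_lab amalgam_lab_sym.

Lemma copy_embedding l : active l -> @embedding A amalgam (copy l).
Proof.
by move=> al; split=> [x|x y]; [apply: part_copy | apply: amalgam_lab_copy].
Qed.

(** The pairs labelled [a] between parts [i] and [j] of a copy are the points of its line, so a
    monochromatic line gives a copy on which these pairs have one colour. *)
Lemma copy_letter l (e : letter) :
  (copy l (val e).1 = inl (true, [ffun t => (val (line_point l e t)).1])) *
  (copy l (val e).2 = inl (false, [ffun t => (val (line_point l e t)).2])).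
Proof.
case/and3P: (valP e) => ei ej _.
rewrite /copy ei ej (eqP ej) eq_sym (negbTE ij).
by split; congr (inl (_, _)); apply/ffunP => t; rewrite !ffunE; case: (l t).
Qed.

End Amalgam.

Definition constant_on (S : Type) (A : system) (chi : A -> A -> S)
    (i j : I) (a : K) :=
  forall x y x' y' : A,
    part x = i -> part y = j -> lab x y = a ->
    part x' = i -> part y' = j -> lab x' y' = a ->
    chi x y = chi x' y'.

Lemma partite_step (S : finType) (A : system) (i j : I) (a : K) : i != j ->
  exists B : system, forall chi : B -> B -> S,
    exists2 phi : A -> B, embedding phi
      & constant_on (fun x y => chi (phi x) (phi y)) i j a.
Proof.
move=> ij; have [J HJ] := hales_jewett (letter A i j a) S.
exists (amalgam A a J ij) => chi.
pose word b (pr : letter A i j a -> A) (w : {ffun J -> letter A i j a}) :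
  amalgam A a J ij := inl (b, [ffun t => pr (w t)]).
have [l [al mono]] := HJ (fun w =>
  chi (word true (fun e => (val e).1) w) (word false (fun e => (val e).2) w)).
exists (copy l); first exact: copy_embedding.
have key x y (xy : [&& part x == i, part y == j & lab x y == a]) :
    chi (copy l x) (copy l y)
    = chi (copy l (val (exist _ (x, y) xy : letter A i j a)).1)
          (copy l (val (exist _ (x, y) xy : letter A i j a)).2) by [].
move=> x y x' y' xi yj xya xi' yj' xya'.
have xy : [&& part x == i, part y == j & lab x y == a].
  by rewrite xi yj xya !eqxx.
have xy' : [&& part x' == i, part y' == j & lab x' y' == a].
  by rewrite xi' yj' xya' !eqxx.
rewrite (key _ _ xy) (key _ _ xy') !(copy_letter ij).
exact: mono.
Qed.

(** Triples are treated one at a time; constancy for one of them passes to smaller copies, since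
    embeddings preserve parts and labels. *)
Lemma partite_iter (S : finType) (A : system) (s : seq (I * I * K)) :
  exists B : system, forall chi : B -> B -> S,
    exists2 phi : A -> B, embedding phi
      & forall i j a, (i, j, a) \in s -> i != j ->
          constant_on (fun x y => chi (phi x) (phi y)) i j a.
Proof.
elim: s => [|[[i j] a] s [B1 IH]].
  by exists A => chi; exists id.
have [ij|ij] := eqVneq i j.
  exists B1 => chi; have [phi ephi cphi] := IH chi; exists phi => // i' j' a'.
  rewrite inE => /orP[/eqP[-> -> _]|]; last exact: cphi.
  by rewrite ij eqxx.
have [B2 stepB] := partite_step S B1 a ij.
exists B2 => chi; have [psi [ppsi lpsi] cpsi] := stepB chi.
have [phi [pphi lphi] cphi] := IH (fun x y => chi (psi x) (psi y)).
exists (psi \o phi).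
  split=> [x|x y xy] /=; first by rewrite ppsi pphi.
  by rewrite lpsi ?lphi // !pphi.
move=> i' j' a'; rewrite inE => /orP[/eqP[-> -> ->] _|]; last exact: cphi.
move=> x y x' y' xi yj xya xi' yj' xya' /=.
by apply: cpsi; rewrite ?pphi ?lphi ?xi ?yj ?xi' ?yj'.
Qed.

Theorem partite_ramsey (S : finType) (k0 : K) :
  exists B : system, forall chi : B -> B -> S,
    exists F : I -> I -> K -> S, forall g : {ffun {set I} -> K},
      exists2 v : I -> B, (forall i, part (v i) = i)
        & forall i j, i != j -> lab (v i) (v j) = g [set i; j] /\
            chi (v i) (v j) = F i j (g [set i; j]).
Proof.
(* [A] consists of one transversal for each labelling [g]; [k0] labels the pairs across different
   transversals. *)
pose labA (x y : I * {ffun {set I} -> K}) :=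
  if x.2 == y.2 then x.2 [set x.1; y.1] else k0.
have labA_sym x y : labA x y = labA y x.
  by rewrite /labA eq_sym setUC; case: eqP => // ->.
pose A := @System (I * {ffun {set I} -> K})%type fst labA labA_sym.
have [B HB] := partite_iter S A (enum {: I * I * K}).
exists B => chi; have [phi [pphi lphi] cphi] := HB chi.
(* By constancy, [F] can be read off the transversals with constant labellings. *)
exists (fun i j a => chi (phi (i, [ffun=> a])) (phi (j, [ffun=> a]))) => g.
exists (fun i => phi (i, g)) => [i|i j ij]; first by rewrite pphi.
split; first by rewrite lphi //= /labA eqxx.
apply: (cphi i j (g [set i; j])) => //=; rewrite ?mem_enum // /labA /= eqxx //.
by rewrite ffunE.
Qed.

End PartiteSystems.

(** * Ramsey theorems for pairs, grids and several orders *)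

Lemma pigeonhole (T : Type) (S : finType) (c0 : S) (f : T -> S) k (s : seq T) :
  #|S| * k <= size s -> exists c, k <= size [seq x <- s | f x == c].
Proof.
move=> les; have [/existsP//|] := boolP [exists c, k <= size [seq x <- s | f x == c]].
rewrite negb_exists => /forallP small.
have sumE : \sum_(c : S) size [seq x <- s | f x == c] = size s.
  elim: s {les small} => [|x s IH] /=; first by rewrite big1.
  rewrite -IH (bigD1 (f x)) //= eqxx /= [in RHS](bigD1 (f x)) //=.
  by congr (_.+1 + _); apply: eq_bigr => c; rewrite eq_sym => /negbTE->.
suff: size s < #|S| * k by rewrite ltnNge les.
rewrite -sumE -sum_nat_const (bigD1 c0) //= [ltnRHS](bigD1 c0) //=.
rewrite -addSn leq_add //; first by rewrite ltnNge small.
by apply: leq_sum => c _; rewrite ltnW // ltnNge small.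
Qed.

(** An entry [(x, c)] records that [x] has colour [c] with all later entries. The head is kept, and
    pigeonhole retains [N] further elements with one colour towards it. *)
Lemma end_homogeneous (S : finType) m :
  exists N, forall (T : eqType) (Phi : T -> T -> S) (s : seq T), N <= size s ->
    exists l : seq (T * S), [/\ size l = m, subseq (map fst l) s
      & pairwise (fun p q => Phi p.1 q.1 == p.2) l].
Proof.
elim: m => [|m [N IH]].
  by exists 0 => T Phi s _; exists [::]; rewrite sub0seq.
exists (#|S| * N).+1 => T Phi [|x s] //= les.
have [c leN] := pigeonhole (Phi x x) (Phi x) les.
have [l [sl subl pl]] := IH T Phi _ leN.
exists ((x, c) :: l); split=> /=; first by rewrite sl.
  by rewrite eqxx; apply: subseq_trans subl (filter_subseq _ _).
rewrite pl andbT; apply/allP => -[y d] yl /=.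
have: y \in [seq y <- s | Phi x y == c].
  by apply: (mem_subseq subl); apply/mapP; exists (y, d).
by rewrite mem_filter => /andP[].
Qed.

Lemma ramsey_pairs (S : finType) n :
  exists2 N, n <= N & forall Phi : 'I_N -> 'I_N -> S, exists2 h : 'I_n -> 'I_N,
    {homo h : i j / i < j} & forall i j i' j' : 'I_n, i < j -> i' < j' ->
      Phi (h i) (h j) = Phi (h i') (h j').
Proof.
have [N HN] := end_homogeneous S (#|S| * n).
(* The summand [n] gives the required lower bound; the successor provides [ord0], hence a colour for
   [pigeonhole]. *)
exists (N + n).+1 => [|Phi]; first by rewrite leqW // leq_addl.
pose c0 := Phi ord0 ord0.
have [|l [sl subl pl]] := HN _ Phi (enum 'I_(N + n).+1).
  by rewrite size_enum_ord leqW // leq_addr.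
have [c lec] := pigeonhole c0 (fun p : 'I_(N + n).+1 * S => p.2) (eq_leq (esym sl)).
set l' := filter _ l in lec.
pose e (i : nat) := nth (ord0, c) l' i.
have Phic i j : i < j < n -> Phi (e i).1 (e j).1 = c.
  case/andP=> ij jn; have jl := leq_trans jn lec; have il := ltn_trans ij jl.
  have /(pairwiseP (ord0, c))/(_ i j il jl ij)/eqP-> :
    pairwise (fun p q : 'I_(N + n).+1 * S => Phi p.1 q.1 == p.2) l'.
    exact: pairwise_filter.
  by have := mem_nth (ord0, c) il; rewrite mem_filter => /andP[/eqP].
have sub' : subseq (map fst l') (enum 'I_(N + n).+1).
  by apply: subseq_trans subl; rewrite map_subseq // filter_subseq.
have sort' : pairwise ltn (map val (map fst l')).
  rewrite -sorted_pairwise; last exact: ltn_trans.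
  apply: (subseq_sorted ltn_trans (map_subseq val sub')).
  by rewrite val_enum_ord iota_ltn_sorted.
have ltne i j : i < j < n -> (e i).1 < (e j).1.
  case/andP=> ij jn; have jl := leq_trans jn lec; have il := ltn_trans ij jl.
  have /(pairwiseP 0)/(_ i j) := sort'.
  rewrite !inE !size_map => /(_ il jl ij).
  by rewrite -!map_comp !(nth_map (ord0, c)).
exists (fun i : 'I_n => (e i).1) => [i j ij|i j i' j' ij ij'].
  by apply: ltne; rewrite ij ltn_ord.
by rewrite !Phic ?ij ?ij' ?ltn_ord.
Qed.

Section ProductRamsey.

Variable r : nat.

Definition grid n : finType := {ffun 'I_r -> 'I_n}.

Definition below n (u v : grid n) := forall s, u s < v s.

Definition grid_map n N (e : 'I_r -> 'I_n -> 'I_N) (u : grid n) : grid N :=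
  [ffun s => e s (u s)].

(** [D] lists the coordinates whose values no longer affect the colour; Ramsey for pairs adds them
    one by one. *)
Lemma ramsey_coordinates (S : finType) (D : seq 'I_r) n :
  exists N, forall Phi : grid N -> grid N -> S,
    exists2 e : 'I_r -> 'I_n -> 'I_N, forall s, {homo e s : i j / i < j}
      & forall u v u' v', below u v -> below u' v' ->
          (forall s, s \notin D -> u s = u' s /\ v s = v' s) ->
          Phi (grid_map e u) (grid_map e v) = Phi (grid_map e u') (grid_map e v').
Proof.
elim: D n => [|t D IH] n.
  exists n => Phi; exists (fun _ i => i) => [s i j|u v u' v' _ _ uv] //.
  have -> : u = u' by apply/ffunP => s; case: (uv s).
  by have -> : v = v' by apply/ffunP => s; case: (uv s).
(* In coordinate [t], a pair of values is coloured by the table of colours over all pairs of points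
   of the small grid, so one use of Ramsey serves them all. *)
have [n1 le1 Hn1] := ramsey_pairs {ffun grid n * grid n -> S} n.
have [N HN] := IH n1; exists N => Phi; have [e mono_e homo_e] := HN Phi.
pose upd (i : 'I_n1) (u : grid n) : grid n1 :=
  [ffun s => if s == t then i else widen_ord le1 (u s)].
have [h mono_h homo_h] := Hn1 (fun i j => [ffun uv : grid n * grid n =>
  Phi (grid_map e (upd i uv.1)) (grid_map e (upd j uv.2))]).
pose e' s i := e s (if s == t then h i else widen_ord le1 i).
exists e' => [s i j ij|u v u' v' uv uv' agree].
  by apply: mono_e; case: (s == t); first exact: mono_h.
have mapE w : grid_map e' w = grid_map e (upd (h (w t)) w).
  by apply/ffunP => s; rewrite !ffunE /e'; case: eqP => [->|].
have below_upd (w w' : grid n) (i j : 'I_n1) : below w w' -> i < j -> below (upd i w) (upd j w').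
  by move=> ww' ij s; rewrite !ffunE; case: eqP => // _; apply: ww'.
(* The values in coordinate [t] are exchanged first; [homo_e] then exchanges those in [D]. *)
have /ffunP/(_ (u, v)) := homo_h _ _ _ _ (uv t) (uv' t).
rewrite !mapE !ffunE /= => ->.
apply: homo_e; try by apply: below_upd => //; apply: mono_h.
move=> s sD; rewrite !ffunE; case: eqVneq => // st.
by have [|-> ->] := agree s; rewrite // inE negb_or st.
Qed.

Theorem product_ramsey (S : finType) n :
  exists N, forall Phi : grid N -> grid N -> S,
    exists2 e : 'I_r -> 'I_n -> 'I_N, forall s, {homo e s : i j / i < j}
      & forall u v u' v', below u v -> below u' v' ->
          Phi (grid_map e u) (grid_map e v) = Phi (grid_map e u') (grid_map e v').
Proof.
have [N HN] := ramsey_coordinates S (enum 'I_r) n.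
exists N => Phi; have [e mono_e homo_e] := HN Phi.
exists e => // u v u' v' uv uv'; apply: homo_e => // s.
by rewrite mem_enum.
Qed.

End ProductRamsey.

(** * Labelled pairs in several linear orders *)

Definition sign_pattern r : finType := {ffun 'I_r -> bool}.

Lemma ltn_lexicographic b x y m n : x < b -> y < b -> m != n ->
  (m * b + x < n * b + y) = (m < n).
Proof.
have lt_lex m' n' x' y' : x' < b -> m' < n' -> m' * b + x' < n' * b + y'.
  move=> lt_x' lt_mn; apply: (@leq_trans (m'.+1 * b)).
    by rewrite mulSn addnC ltn_add2r.
  by rewrite (leq_trans (leq_mul lt_mn (leqnn b))) ?leq_addr.
move=> lt_x lt_y; case: (ltngtP m n) => // lt_mn _; first exact: lt_lex.
by apply/negbTE; rewrite -leqNgt ltnW ?lt_lex.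
Qed.

(** Grid points index the parts of a partite system. Partite Ramsey makes the colour depend on the
    two parts and the label; product Ramsey reduces the two parts to their sign pattern. *)
Theorem ramsey_orders (r : nat) (K S : finType) (n : nat) (k0 : K) : 0 < r ->
  exists (X : finType) (lab : X -> X -> K) (rho : 'I_r -> X -> nat),
    [/\ forall x y, lab x y = lab y x, forall s, injective (rho s)
      & forall chi : X -> X -> S, exists Psi : sign_pattern r -> K -> S,
          forall (u : 'I_r -> 'I_n.+2 -> 'I_n.+2) (g : {set 'I_n.+2} -> K),
          (forall s, injective (u s)) ->
          exists v : 'I_n.+2 -> X, forall i j, i != j ->
            [/\ forall s, (rho s (v i) < rho s (v j)) = (u s i < u s j),
                lab (v i) (v j) = g [set i; j]
              & chi (v i) (v j) = Psi [ffun s => u s i < u s j] (g [set i; j])]].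
Proof.
move=> r_gt0.
have [N HN] := product_ramsey r {ffun sign_pattern r -> {ffun K -> S}} n.+2.
have [B HB] := partite_ramsey (grid r N) S k0.
(* Order [s] compares the coordinates [s] of the parts and breaks ties by rank. *)
exists B, (@lab _ _ B), (fun s (x : B) => (part x : grid r N) s * #|B| + enum_rank x).
have rank_lt (x : B) : enum_rank x < #|B| by [].
split; first exact: lab_sym.
  move=> s x y e; apply/enum_rank_inj/val_inj => /=.
  by move/(congr1 (modn^~ #|B|)): e; rewrite !modnMDl !modn_small.
move=> chi; have [F HF] := HB chi.
(* Two points that differ in every coordinate are [mix p lo hi] and [mix p hi lo], for their
   coordinatewise minimum [lo] and maximum [hi]. *)
pose mix (p : sign_pattern r) (lo hi : grid r N) : grid r N :=
  [ffun s => if p s then lo s else hi s].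
have [e mono_e homo_e] := HN (fun lo hi => [ffun p => [ffun a =>
  F (mix p lo hi) (mix p hi lo) a]]).
(* A reference pair: as [n.+2] is at least two, [lo0] lies below [hi0]. *)
pose lo0 : grid r n.+2 := [ffun=> ord0].
pose hi0 : grid r n.+2 := [ffun=> ord_max].
pose Psi p a := F (mix p (grid_map e lo0) (grid_map e hi0))
                  (mix p (grid_map e hi0) (grid_map e lo0)) a.
have FE p a lo hi : below lo hi ->
    F (mix p (grid_map e lo) (grid_map e hi))
      (mix p (grid_map e hi) (grid_map e lo)) a = Psi p a.
  move=> lohi; have /homo_e/(_ lohi)/ffunP/(_ p)/ffunP/(_ a) : below lo0 hi0.
    by move=> s; rewrite !ffunE.
  by rewrite !ffunE.
have eltE s i j : (e s i < e s j) = (i < j).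
  case: (ltngtP i j) => [/(mono_e s)->//|/(mono_e s)/ltnW|/val_inj->].
    by rewrite leqNgt => /negbTE->.
  by rewrite ltnn.
have inj_e s : injective (e s).
  move=> i j eij; have := eltE s j i; have := eltE s i j.
  by rewrite eij ltnn; case: ltngtP => // /val_inj.
exists Psi => u g inj_u.
pose pt i : grid r N := grid_map e [ffun s => u s i].
have ptE i s : pt i s = e s (u s i) by rewrite !ffunE.
have ptneq i j s : i != j -> pt i s != pt j s.
  by rewrite !ptE (inj_eq (@inj_e s)) (inj_eq (inj_u s)).
have pt_inj : injective pt.
  move=> i j e_ij; apply/eqP/negP => /negP/(ptneq _ _ (Ordinal r_gt0)).
  by rewrite e_ij eqxx.
have [v partv Hv] := HF [ffun D : {set grid r N} => g (pt @^-1: D)].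
exists (fun i => v (pt i)) => i j ij.
have pre : pt @^-1: [set pt i; pt j] = [set i; j].
  by apply/setP => k; rewrite !inE !(inj_eq pt_inj).
have [|labv chiv] := Hv (pt i) (pt j); first by rewrite (inj_eq pt_inj).
rewrite ffunE pre in labv chiv; split=> //.
  move=> s; rewrite !partv -(eltE s) -!ptE.
  by apply: ltn_lexicographic; rewrite // (inj_eq val_inj) ptneq.
rewrite chiv; set p := [ffun s => _].
pose lo : grid r n.+2 := [ffun s => if p s then u s i else u s j].
pose hi : grid r n.+2 := [ffun s => if p s then u s j else u s i].
rewrite -(FE p _ lo hi); last first.
  move=> s; rewrite !ffunE; case: (ltngtP (u s i) (u s j)) => // /val_inj/inj_u.
  by move/eqP; rewrite (negbTE ij).
by congr (F _ _ _); apply/ffunP => s; rewrite !ffunE; case: (u s i < u s j).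
Qed.

(** * Configurations of three points *)

Definition flip r (p : sign_pattern r) : sign_pattern r := [ffun s => ~~ p s].

Section ThreePoints.

Let i0 : 'I_3 := @Ordinal 3 0 isT.
Let i1 : 'I_3 := @Ordinal 3 1 isT.
Let i2 : 'I_3 := @Ordinal 3 2 isT.

(** The hypothesis excludes the two cyclic orientations; [u] sends a point to the number of points
    below it. *)
Lemma three_point_order (b01 b12 b02 : bool) : (b01 = b12 -> b02 = b01) ->
  exists2 u : {ffun 'I_3 -> 'I_3}, injective u
    & [/\ (u i0 < u i1) = b01, (u i1 < u i2) = b12 & (u i0 < u i2) = b02].
Proof.
pose ord3 k := match k with 0 => i0 | 1 => i1 | _ => i2 end.
pose u := [ffun i : 'I_3 => ord3 (match val i with
  | 0 => ~~ b01 + ~~ b02 | 1 => b01 + ~~ b12 | _ => b02 + b12 end)].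
move=> valid; exists u; last first.
  rewrite !ffunE /=.
  by case: b01 b12 b02 valid {u} => [] [] [] // /(_ erefl).
move=> i j; rewrite !ffunE => /(congr1 val) e; apply: val_inj => /=; move: e.
case: i j => [[|[|[|//]]] /= _] [[|[|[|//]]] /= _] //;
by case: b01 b12 b02 valid {u} => [] [] [] // /(_ erefl).
Qed.

Lemma ramsey_three_points (r : nat) (K S : finType) (k0 : K) : 0 < r ->
  exists (X : finType) (lab : X -> X -> K) (rho : 'I_r -> X -> nat),
    [/\ forall x y, lab x y = lab y x, forall s, injective (rho s)
      & forall chi : X -> X -> S, exists Psi : sign_pattern r -> K -> S,
          forall (p01 p12 p02 : sign_pattern r) (a01 a12 a02 : K),
          (forall s, p01 s = p12 s -> p02 s = p01 s) ->
          exists x y z,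
            [/\ [/\ x != y, y != z & x != z],
                forall s, [/\ (rho s x < rho s y) = p01 s,
                  (rho s y < rho s z) = p12 s & (rho s x < rho s z) = p02 s],
                [/\ lab x y = a01, lab y z = a12 & lab x z = a02],
                [/\ chi x y = Psi p01 a01, chi y z = Psi p12 a12
                  & chi x z = Psi p02 a02]
              & chi y x = Psi (flip p01) a01]].
Proof.
move=> r_gt0; have [X [lab [rho [labC inj_rho HX]]]] := ramsey_orders S 1 k0 r_gt0.
exists X, lab, rho; split=> // chi; have [Psi HPsi] := HX chi.
exists Psi => p01 p12 p02 a01 a12 a02 valid.
have /fin_all_exists2[u inj_u uE] s := three_point_order (valid s).
(* A pair is recognised by the point it omits. *)
pose g (D : {set 'I_3}) :=
  if i2 \notin D then a01 else if i0 \notin D then a12 else a02.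
have [v Hv] := HPsi u g inj_u.
have [rho01 lab01 chi01] := Hv i0 i1 isT.
have [rho10 _ chi10] := Hv i1 i0 isT.
have [rho12 lab12 chi12] := Hv i1 i2 isT.
have [rho02 lab02 chi02] := Hv i0 i2 isT.
have neqv i j : i != j -> v i != v j.
  move=> ij; apply: contraNneq (ij) => e; have ji : j != i by rewrite eq_sym.
  have [/(_ (Ordinal r_gt0)) lt_ij _ _] := Hv i j ij.
  have [/(_ (Ordinal r_gt0)) lt_ji _ _] := Hv j i ji.
  move: lt_ij lt_ji; rewrite e ltnn.
  by case: ltngtP => // /val_inj/inj_u ->.
have patternE i j (p : sign_pattern r) : (forall s, (u s i < u s j) = p s) ->
    [ffun s => u s i < u s j] = p :> sign_pattern r.
  by move=> E; apply/ffunP => s; rewrite ffunE.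
have p01E : [ffun s => u s i0 < u s i1] = p01 by apply: patternE => s; case: (uE s).
have p12E : [ffun s => u s i1 < u s i2] = p12 by apply: patternE => s; case: (uE s).
have p02E : [ffun s => u s i0 < u s i2] = p02 by apply: patternE => s; case: (uE s).
have p10E : [ffun s => u s i1 < u s i0] = flip p01.
  apply: patternE => s; rewrite ffunE; case: (uE s) => <- _ _.
  by case: ltngtP => // /val_inj/inj_u.
have gE : [/\ g [set i0; i1] = a01, g [set i1; i0] = a01, g [set i1; i2] = a12
            & g [set i0; i2] = a02] by rewrite /g !inE.
case: gE => g01 g10 g12 g02.
exists (v i0), (v i1), (v i2); split.
- by rewrite !neqv.
- by move=> s; rewrite rho01 rho12 rho02; apply: uE.
- by rewrite lab01 lab12 lab02.
- by rewrite chi01 chi12 chi02 p01E p12E p02E g01 g12 g02.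
- by rewrite chi10 p10E g10.
Qed.

End ThreePoints.

(* The patterns with [tau p] form an ultrafilter on ['I_r], or the complements
   of one; as in Arrow's theorem, finiteness makes it principal. *)
Lemma sign_dictator r (tau : sign_pattern r -> bool) :
  (forall p, tau (flip p) = ~~ tau p) ->
  (forall p p' p'' : sign_pattern r, tau p -> tau p' ->
     (forall s, p s = p' s -> p'' s = p s) -> tau p'') ->
  exists q b, forall p, tau p = (p q == b).
Proof.
pose one : sign_pattern r := [ffun=> true].
have principal tau' : (forall p, tau' (flip p) = ~~ tau' p) ->
    (forall p p' p'' : sign_pattern r, tau' p -> tau' p' ->
       (forall s, p s = p' s -> p'' s = p s) -> tau' p'') ->
    tau' one -> exists q, forall p, tau' p = p q.
  move=> tauN tau_between tau1.
  (* The intersection of the members of the family that occur in [l]; betweenness keeps it in the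
     family. *)
  pose meet (l : seq (sign_pattern r)) : sign_pattern r :=
    [ffun s => all (fun p : sign_pattern r => tau' p ==> p s) l].
  have tau_meet l : tau' (meet l).
    elim: l => [|p l IH].
      by have -> : meet [::] = one by apply/ffunP => s; rewrite !ffunE.
    have [tp|tp] := boolP (tau' p).
      apply: (tau_between _ _ _ tp IH) => s; rewrite !ffunE /= tp /= => <-.
      by rewrite andbb.
    have -> // : meet (p :: l) = meet l.
    by apply/ffunP => s; rewrite !ffunE /= (negbTE tp).
  pose m := meet (enum {: sign_pattern r}).
  (* If [m] were empty, its complement [one] could not be in the family. *)
  have [q mq|m0] := pickP (fun s => m s); last first.
    have : tau' (flip m).
      have -> // : flip m = one by apply/ffunP => s; rewrite ffunE (m0 s) ffunE.
    by rewrite tauN tau_meet.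
  have tau_q p : tau' p -> p q.
    move: mq; rewrite ffunE => /allP/(_ p); rewrite mem_enum => /(_ isT)/implyP.
    exact.
  exists q => p; apply/idP/idP => [|pq]; first exact: tau_q.
  apply: contraLR pq; rewrite -tauN => /tau_q.
  by rewrite ffunE.
move=> tauN tau_between; have [tau1|tau0] := boolP (tau one).
  have [q tauE] := principal _ tauN tau_between tau1.
  by exists q, true => p; rewrite tauE eqb_id.
(* The complementary family satisfies the same hypotheses and contains [one]. *)
have [||//|q tauE] := principal (fun p => ~~ tau p).
- by move=> p; rewrite tauN.
- move=> p p' p''; rewrite -!tauN => tp tp' pp'; apply: (tau_between _ _ _ tp tp') => s.
  by rewrite !ffunE => /negb_inj/pp'->.
by exists q, false => p; rewrite eqbF_neg -tauE negbK.
Qed.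

(** * Colourings and symmetrized palettes *)

Section LinearOrders.

Variables (V : finType) (o : linear_order V).

Lemma precxx x : prec o x x = false.
Proof. by rewrite /prec eqxx. Qed.

Lemma prec_neq x y : prec o x y -> x != y.
Proof. by case/andP. Qed.

Lemma precN x y : x != y -> prec o y x = ~~ prec o x y.
Proof.
move=> xy; rewrite /prec eq_sym xy /=.
have := le_total o x y; case oxy: (o x y); case oyx: (o y x) => //= _.
by case/eqP: xy; apply: (@le_anti _ o); rewrite oxy.
Qed.

Lemma prec_asym x y : prec o x y -> prec o y x = false.
Proof. by move=> xy; rewrite precN ?xy // prec_neq. Qed.

Lemma prec_trans : transitive (prec o).
Proof.
move=> y x z xy yz; apply/andP; split; last first.
  by apply: (@le_trans _ o y); [case/andP: xy | case/andP: yz].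
by apply: contraTneq xy => ->; rewrite prec_asym.
Qed.

Definition rev_order : linear_order V.
Proof.
apply: (@LinearOrder V (fun x y => o y x)).
- exact: le_refl.
- by move=> x y; rewrite andbC; apply: le_anti.
- by move=> y x z xy yz; apply: (@le_trans _ o y).
- by move=> x y; apply: le_total.
Defined.

Lemma prec_rev x y : prec rev_order x y = prec o y x.
Proof. by rewrite /prec eq_sym. Qed.

End LinearOrders.

Definition rank_order (V : finType) (rho : V -> nat) (inj_rho : injective rho) :
  linear_order V.
Proof.
apply: (@LinearOrder V (fun x y => rho x <= rho y)).
- by move=> x /=.
- by move=> x y /anti_leq/inj_rho.
- by move=> y x z; apply: leq_trans.
- by move=> x y; apply: leq_total.
Defined.

Lemma prec_rank (V : finType) (rho : V -> nat) (inj_rho : injective rho) x y :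
  prec (rank_order inj_rho) x y = (rho x < rho y).
Proof. by rewrite /prec /= ltn_neqAle (inj_eq inj_rho). Qed.

Section Symmetrization.

Variable P : palette.

(** The six clauses are the six linear orders of three points, a bar marking a reversed pair; the
    two missing bar patterns are the cyclic ones. *)
Lemma sym_feasibleE (X Y Z : color P + color P) :
  ((X, Y, Z) \in feasible (sym_palette P)) =
  match X, Y, Z with
  | inl x, inl y, inl z | inr x, inl z, inl y | inl y, inl x, inr z
  | inr y, inr z, inl x | inl z, inr x, inr y | inr z, inr y, inr x =>
      (x, y, z) \in feasible P
  | _, _, _ => false
  end.
Proof.
apply/bigcupP/idP.
  case=> -[[x y] z] T; rewrite !inE.
  by do ![case/orP]; move=> /eqP[-> -> ->].
case: X Y Z => [x|x] [y|y] [z|z] // T.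
- by exists (x, y, z) => //; rewrite !inE eqxx ?orbT.
- by exists (y, x, z) => //; rewrite !inE eqxx ?orbT.
- by exists (y, z, x) => //; rewrite !inE eqxx ?orbT.
- by exists (x, z, y) => //; rewrite !inE eqxx ?orbT.
- by exists (z, x, y) => //; rewrite !inE eqxx ?orbT.
- by exists (z, y, x) => //; rewrite !inE eqxx ?orbT.
Qed.

Definition unbarred (X : color P + color P) : bool := if X is inl _ then true else false.

Definition base_color (X : color P + color P) : color P :=
  match X with inl x | inr x => x end.

Definition bar_unless (b : bool) (x : color P) : color P + color P :=
  if b then inl x else inr x.

Lemma bar_unlessK X : bar_unless (unbarred X) (base_color X) = X.
Proof. by case: X. Qed.

(** The absence of cyclic bar patterns is the compatibility that [ramsey_three_points] asks of its
    sign patterns. *)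
Lemma sym_feasible_transitive X Y Z : (X, Y, Z) \in feasible (sym_palette P) ->
  unbarred X = unbarred Z -> unbarred Y = unbarred X.
Proof. by rewrite sym_feasibleE; case: X Y Z => [?|?] [?|?] [?|?]. Qed.

Variables (V : finType) (o : linear_order V) (c : V -> V -> color P).
Hypothesis cC : forall x y, c x y = c y x.

Lemma sym_feasible_of_sorted u v w : u != v -> v != w -> u != w ->
  (forall x y z, [set x; y; z] = [set u; v; w] -> prec o x y -> prec o y z ->
     (c x y, c x z, c y z) \in feasible P) ->
  (bar_unless (prec o u v) (c u v), bar_unless (prec o u w) (c u w),
   bar_unless (prec o v w) (c v w)) \in feasible (sym_palette P).
Proof.
move=> uv vw uw sorted_ok; rewrite sym_feasibleE.
have permL (x y z : V) : [set x; y; z] = [set y; x; z].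
  by rewrite (setUC [set x]).
have permR (x y z : V) : [set x; y; z] = [set x; z; y] by rewrite setUAC.
have vuE := precN o uv; have wvE := precN o vw; have wuE := precN o uw.
(* Of the eight sign cases, transitivity of [o] excludes the two cyclic ones. *)
case uvE: (prec o u v) vuE => /= vuE; case vwE: (prec o v w) wvE => /= wvE;
  case uwE: (prec o u w) wuE => /= wuE.
- exact: sorted_ok.
- by have := prec_trans uvE vwE; rewrite uwE.
- by rewrite (cC v w); apply: sorted_ok; rewrite // permR.
- by rewrite (cC u w) (cC v w); apply: sorted_ok; rewrite // permL permR.
- by rewrite (cC u v); apply: sorted_ok; rewrite // permL.
- by rewrite (cC u v) (cC u w); apply: sorted_ok; rewrite // permR permL.
- by have := prec_trans wvE vuE; rewrite wuE.
- rewrite (cC u v) (cC u w) (cC v w); apply: sorted_ok => //.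
  by rewrite permL permR permL.
Qed.

Lemma sorted_of_sym_feasible u v w x y z :
  (bar_unless (prec o u v) (c u v), bar_unless (prec o u w) (c u w),
   bar_unless (prec o v w) (c v w)) \in feasible (sym_palette P) ->
  [set x; y; z] = [set u; v; w] -> prec o x y -> prec o y z ->
  (c x y, c x z, c y z) \in feasible P.
Proof.
move=> T /setP E xy yz; have xz := prec_trans xy yz; move: T.
have [] : [/\ x \in [set u; v; w], y \in [set u; v; w] & z \in [set u; v; w]].
  by rewrite -!E !inE !eqxx ?orbT.
rewrite !inE -!orbA => /or3P[]/eqP ? /or3P[]/eqP ? /or3P[]/eqP ?; subst;
  rewrite ?precxx // in xy yz xz *;
  rewrite ?xy ?yz ?xz ?(prec_asym xy) ?(prec_asym yz) ?(prec_asym xz);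
  rewrite sym_feasibleE /=; by rewrite ?(cC v u) ?(cC w u) ?(cC w v).
Qed.

End Symmetrization.

Lemma set3_rev (V : finType) (x y z : V) : [set x; y; z] = [set z; y; x].
Proof. by rewrite setUC (setUC [set x]) setUA. Qed.

Lemma colorable_of_homomorphic (P Q : palette) (H : hypergraph) :
  homomorphic P Q -> colorable P H -> colorable Q H.
Proof.
case=> f fT [o [c cT]]; exists o, (f \o c) => u v w uvw uv vw.
exact/fT/cT.
Qed.

Lemma colorable_inv (P : palette) (H : hypergraph) :
  colorable (inv_palette P) H -> colorable P H.
Proof.
case=> o [c cT]; exists (rev_order o), c => u v w uvw.
rewrite !prec_rev => vu wv; have := cT w v u.
rewrite /= inE set3_rev => /(_ uvw wv vu).
by rewrite (setUC [set w] [set v]) (setUC [set w] [set u]) (setUC [set v] [set u]).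
Qed.

(** * Mixed palettes *)

Section MixedPalette.

Variables (r : nat) (P : 'I_r -> palette) (q : 'I_r).

Lemma mixed_feasibleE (X Y Z : color (mixed_palette P q)) :
  ((X, Y, Z) \in feasible (mixed_palette P q)) =
  ((X.1, Y.1, Z.1) \in feasible (P q)) &&
  [forall s : {s : 'I_r | s != q},
    (X.2 s, Y.2 s, Z.2 s) \in feasible (sym_palette (P (val s)))].
Proof. by rewrite !inE. Qed.

Lemma mixed_colorable (H : hypergraph) :
  (forall s, colorable (P s) H) -> colorable (mixed_palette P q) H.
Proof.
case/fin_all_exists=> o /fin_all_exists[c cT].
(* Colours belong to unordered pairs, so agreement of [o s] with [o q] is stated over both listings
   of the pair. *)
pose agree s (e : {set vertex H}) :=
  [forall x in e, forall y in e, prec (o q) x y ==> prec (o s) x y].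
pose cmix e : color (mixed_palette P q) :=
  (c q e, [ffun s : {s : 'I_r | s != q} =>
             bar_unless (agree (val s) e) (c (val s) e)]).
have agreeE s x y : prec (o q) x y -> agree s [set x; y] = prec (o s) x y.
  move=> xy; apply/idP/idP => [|xys].
    move=> /forallP/(_ x)/implyP; rewrite !inE eqxx => /(_ isT)/forallP/(_ y).
    by rewrite !inE eqxx orbT xy.
  apply/forallP => u; apply/implyP => eu; apply/forallP => v; apply/implyP => ev.
  move: eu ev; rewrite !inE => /orP[]/eqP-> /orP[]/eqP->; rewrite ?precxx //.
    by rewrite xys implybT.
  by rewrite prec_asym.
exists (o q), cmix => u v w e uv vw; rewrite mixed_feasibleE /=.
rewrite (cT q u v w e uv vw); apply/forallP => s; rewrite !ffunE.
rewrite !agreeE ?(prec_trans uv vw) //.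
apply: (@sym_feasible_of_sorted _ _ (o (val s)) (fun x y => c (val s) [set x; y])).
- by move=> x y; rewrite setUC.
- exact: prec_neq uv.
- exact: prec_neq vw.
- exact: prec_neq (prec_trans uv vw).
by move=> x y z xyz; apply: cT; rewrite xyz.
Qed.

Lemma not_eq_neq (s t : 'I_r) : s <> t -> s != t.
Proof. by move/eqP. Qed.

(** Colours of [P q] count as unbarred colours of its symmetrization, so that all [s] can be treated
    alike; the factor at [q] needs a cast. *)
Definition unmix (X : color (mixed_palette P q)) (s : 'I_r) :
    color (P s) + color (P s) :=
  match s =P q with
  | ReflectT e => inl (ecast t (color (P t)) (esym e) X.1)
  | ReflectF ne => X.2 (exist _ s (not_eq_neq ne))
  end.

Lemma unmix_feasible X Y Z s : (X, Y, Z) \in feasible (mixed_palette P q) ->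
  (unmix X s, unmix Y s, unmix Z s) \in feasible (sym_palette (P s)).
Proof.
rewrite mixed_feasibleE /unmix => /andP[Tq /forallP Ts].
case: (s =P q) => [e|ne]; last by move: (Ts (exist _ s (not_eq_neq ne))).
by rewrite sym_feasibleE; move: (esym e) => {}e; case: s / e.
Qed.

Lemma unbarred_unmix X : unbarred (unmix X q).
Proof. by rewrite /unmix; case: (q =P q). Qed.

End MixedPalette.

(** Symmetry of [h] makes the picked listing of a pair immaterial; [d] serves the sets that have no
    listing. *)
Lemma symmetric_pair_fun (V : finType) (C : Type) (h : V -> V -> C) (d : C) :
  (forall x y, h x y = h y x) ->
  exists c : {set V} -> C, forall x y, x != y -> c [set x; y] = h x y.
Proof.
move=> hC.
exists (fun D => if [pick p : V * V | D == [set p.1; p.2]] is Some p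
                 then h p.1 p.2 else d) => x y xy.
case: pickP => [[u v] /= /eqP/setP E|/(_ (x, y))]; last by rewrite eqxx.
have := E x; have := E y; rewrite !inE !eqxx orbT /=.
move=> /esym/orP[]/eqP ? /esym/orP[]/eqP ?; subst=> //.
  by rewrite eqxx in xy.
by rewrite eqxx in xy.
Qed.

(** * The hypergraph of feasible triples *)

Section Construction.

Variables (r : nat) (P : 'I_r -> palette) (P0 : palette).

Definition label : finType := {dffun forall s : 'I_r, color (P s)}.

Variables (X : finType) (lab : X -> X -> label) (rho : 'I_r -> X -> nat).
Hypotheses (labC : forall x y, lab x y = lab y x)
  (inj_rho : forall s, injective (rho s)).

Definition feasible_sets : {set {set X}} :=
  [set e : {set X} | (#|e| == 3) &&
    [forall s, forall x, forall y, forall z,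
      [==> e == [set x; y; z], rho s x < rho s y, rho s y < rho s z =>
       (lab x y s, lab x z s, lab y z s) \in feasible (P s)]]].

Lemma feasible_sets_card3 e : e \in feasible_sets -> #|e| = 3.
Proof. by rewrite inE => /andP[/eqP]. Qed.

Definition feasible_hypergraph : hypergraph := Hypergraph feasible_sets_card3.

Lemma feasible_hypergraph_colorable s : colorable (P s) feasible_hypergraph.
Proof.
have /card_gt0P[d _] := color_gt0 (P s).
have [|c cE] := @symmetric_pair_fun X _ (fun x y => lab x y s) d.
  by move=> x y; rewrite labC.
exists (rank_order (@inj_rho s)), c => x y z /=.
rewrite !prec_rank inE => /andP[_ /forallP/(_ s)].
move=> /forallP/(_ x)/forallP/(_ y)/forallP/(_ z); rewrite eqxx => T xy yz.
have neq u v : rho s u < rho s v -> u != v.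
  by move=> uv; apply: contraTneq uv => ->; rewrite ltnn.
rewrite !cE ?neq ?(ltn_trans xy yz) //.
by rewrite xy yz in T.
Qed.

(** Edges are recognised from labels and sign patterns in one fixed listing, without sorting the
    points anew for each order. *)
Lemma mem_feasible_sets (x y z : X) : x != y -> y != z -> x != z ->
  (forall s, (bar_unless (rho s x < rho s y) (lab x y s),
              bar_unless (rho s x < rho s z) (lab x z s),
              bar_unless (rho s y < rho s z) (lab y z s))
             \in feasible (sym_palette (P s))) ->
  [set x; y; z] \in feasible_sets.
Proof.
move=> xy yz xz T; rewrite inE; apply/andP; split.
  by rewrite -setUA cardsU1 cards2 !inE negb_or xy xz yz.
apply/forallP => s; apply/forallP => u; apply/forallP => v; apply/forallP => w.
apply/implyP => /eqP E; apply/implyP => uv; apply/implyP => vw.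
apply: (@sorted_of_sym_feasible _ _ (rank_order (@inj_rho s))
  (fun x y => lab x y s) _ x y z); rewrite ?prec_rank //.
by move=> ? ?; rewrite labC.
Qed.

Variable k0 : label.
Hypothesis ramsey_X :
  forall chi : X -> X -> color P0 * bool,
    exists Psi : sign_pattern r -> label -> color P0 * bool,
      forall (p01 p12 p02 : sign_pattern r) (a01 a12 a02 : label),
      (forall s, p01 s = p12 s -> p02 s = p01 s) ->
      exists x y z,
        [/\ [/\ x != y, y != z & x != z],
            forall s, [/\ (rho s x < rho s y) = p01 s,
              (rho s y < rho s z) = p12 s & (rho s x < rho s z) = p02 s],
            [/\ lab x y = a01, lab y z = a12 & lab x z = a02],
            [/\ chi x y = Psi p01 a01, chi y z = Psi p12 a12
              & chi x z = Psi p02 a02]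
          & chi y x = Psi (flip p01) a01].

Lemma homomorphic_of_colorable : colorable P0 feasible_hypergraph ->
  exists q, homomorphic (mixed_palette P q) P0 \/
            homomorphic (mixed_palette P q) (inv_palette P0).
Proof.
case=> o [c cT].
have [Psi HPsi] := ramsey_X (fun x y => (c [set x; y], prec o x y)).
pose tau p := (Psi p k0).2.
(* On three points with pattern [p] throughout and labels [a], [a], [b], transitivity carries the
   direction from [a] to [b]. *)
have Psi_imp p a b : (Psi p a).2 -> (Psi p b).2.
  have [|x [y [z [_ _ _ [cxy cyz cxz] _]]]] := HPsi p p p a a b; first by [].
  by move=> tp; move: (tp) (tp); rewrite -{1}cxy -cyz -cxz; apply: prec_trans.
have tauE p a : (Psi p a).2 = tau p by apply/idP/idP; apply: Psi_imp.
have tau_flip p : tau (flip p) = ~~ tau p.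
  have [|x [y [z [[xy _ _] _ _ [chixy _ _] chiyx]]]] := HPsi p p p k0 k0 k0.
    by [].
  by rewrite /tau -chixy -chiyx /= precN.
have tau_between (p p' p'' : sign_pattern r) : tau p -> tau p' ->
    (forall s, p s = p' s -> p'' s = p s) -> tau p''.
  move=> tp tp' /(HPsi p p' p'' k0 k0 k0)[x [y [z [_ _ _ [xy yz xz] _]]]].
  move: tp tp'; rewrite /tau -xy -yz -xz; exact: prec_trans.
have [q [b tau_q]] := sign_dictator tau_flip tau_between.
exists q.
(* A mixed colour decodes into a sign pattern, given by its bars, and a label, given by the colours
   underneath. *)
pose sgn (A : color (mixed_palette P q)) : sign_pattern r :=
  [ffun s => unbarred (unmix A s)].
pose raw (A : color (mixed_palette P q)) : label :=
  [ffun s => base_color (unmix A s)].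
pose f A := (Psi (sgn A) (raw A)).1.
have f_edge A B C : (A, B, C) \in feasible (mixed_palette P q) ->
    exists x y z, [/\ [set x; y; z] \in feasible_sets,
      [/\ prec o x y = b, prec o y z = b & (x != y) && (y != z)]
      & [/\ c [set x; y] = f A, c [set x; z] = f B & c [set y; z] = f C]].
  move=> T; have Ts s := unmix_feasible s T.
  have [|x [y [z [[xy yz xz] rhoE [lxy lyz lxz] [cxy cyz cxz] _]]]] :=
    HPsi (sgn A) (sgn C) (sgn B) (raw A) (raw C) (raw B).
    by move=> s; rewrite !ffunE; apply: (sym_feasible_transitive (Ts s)).
  exists x, y, z; split.
  - apply: mem_feasible_sets => // s; have [-> -> ->] := rhoE s.
    by rewrite lxy lyz lxz !ffunE !bar_unlessK.
  (* Mixed colours are unbarred at [q], so their sign patterns all get the direction [b]. *)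
  - have precE A' : (Psi (sgn A') (raw A')).2 = b.
      by rewrite tauE tau_q ffunE unbarred_unmix; case: (b).
    split; last by rewrite xy yz.
      by rewrite -(precE A) -cxy.
    by rewrite -(precE C) -cyz.
  - by rewrite /f -cxy -cyz -cxz.
(* For [b = true] the points [x], [y], [z] increase in [o]; for [b = false] they decrease, which
   reverses the triple of colours and leads to the inverse palette. *)
case: b {tau_q} f_edge => f_edge; [left|right]; exists f => A B C.
  move=> /f_edge[x [y [z [xyz [xy yz _] [<- <- <-]]]]].
  exact: cT.
move=> /f_edge[x [y [z [xyz [xy yz /andP[nxy nyz]] [<- <- <-]]]]].
rewrite inE !(setUC [set x]) (setUC [set y] [set z]).
apply: cT; first by rewrite set3_rev.
  by rewrite (precN o nyz) yz.
by rewrite (precN o nxy) xy.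
Qed.

End Construction.

Theorem theorem5p3 (r : nat) (r_ge1 : 1 <= r)
    (P0 : palette) (P : 'I_r -> palette) :
  (exists H : hypergraph,
     (forall s : 'I_r, colorable (P s) H) /\ ~ colorable P0 H) <->
  (forall q : 'I_r,
     ~ homomorphic (mixed_palette P q) P0 /\
     ~ homomorphic (mixed_palette P q) (inv_palette P0)).
Proof.
split=> [[H [colH ncolH]] q|nohom].
  have colq := mixed_colorable q colH.
  split=> [hom|hom]; apply: ncolH; first exact: colorable_of_homomorphic colq.
  exact/colorable_inv/(colorable_of_homomorphic hom).
have /card_gt0P[k0 _] := prod_color_gt0 P.
have [X [lab [rho [labC inj_rho ramsey_X]]]] :=
  @ramsey_three_points r (label P) (color P0 * bool)%type k0 r_ge1.
exists (feasible_hypergraph lab rho); split.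
  exact: feasible_hypergraph_colorable.
move/(homomorphic_of_colorable labC inj_rho k0 ramsey_X) => [q].
by case: (nohom q) => ? ? [].
Qed.
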